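(* Let $G$ be a finite connected graph. Then $\gamma_b(G) \leq 2\,\mathrm{mp}(G) + 3$.
   Context: For a graph $G=(V,E)$ with distance $d(u,v)$, the ball of radius $r$ around $v$ is $N_r(v)=\{u\in V : d(u,v)\leq r\}$. A dominating broadcast of $G$ is a function $f: V\to \mathbb{N}$ such that for every $u\in V$ there is $v\in V$ with $f(v)>0$ and $d(u,v)\leq f(v)$; its cost is $\sum_{v\in V} f(v)$. The broadcast number $\gamma_b(G)$ is the minimum cost of a dominating broadcast of $G$. A multipacking of $G$ is a set $P\subseteq V$ such that for every vertex $v$ and every positive integer $r$, $|N_r(v)\cap P|\leq r$. The multipacking number $\mathrm{mp}(G)$ is the maximum size of a multipacking of $G$. *)

(* Defs.v *)
From mathcomp Require Import all_boot.
From mathcomp.classical Require Import boolp.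

Set Implicit Arguments.
Unset Strict Implicit.
Unset Printing Implicit Defensive.

(* A finite simple graph is a finType [T] of vertices with a symmetric
   irreflexive adjacency relation [e : rel T]. *)

Definition connected_graph (T : finType) (e : rel T) : Prop :=
  forall u v : T, connect e u v.

Definition walk (T : finType) (e : rel T) (u v : T) (n : nat) : bool :=
  [exists p : n.-tuple T, path e u p && (last u p == v)].

(* A shortest walk has fewer than #|T| edges, so the minimum may be taken over
   n < #|T|; the value #|T| is taken exactly when no walk from [u] to [v]
   exists (see [walk_dist] and [dist_le_walk]). *)
Definition dist (T : finType) (e : rel T) (u v : T) : nat :=
  \big[minn/#|T|]_(n < #|T| | walk e u v n) n.

Lemma dist_le_walk (T : finType) (e : rel T) (u v : T) (n : nat) :
  walk e u v n -> dist e u v <= n.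
Proof.
move=> w; rewrite /dist; case: (ltnP n #|T|) => [ltn|len]; last first.
  apply: leq_trans len; elim/big_rec: _ => // i x _ le_x.
  by rewrite geq_min le_x orbT.
have := mem_index_enum (Ordinal ltn).
elim: (index_enum _) => // i s IHs; rewrite inE big_cons => /predU1P[<-|/IHs le_s].
  by rewrite /= w geq_minl.
by case: ifP => // _; rewrite geq_min le_s orbT.
Qed.

Lemma walk_dist (T : finType) (e : rel T) (u v : T) :
  connect e u v -> walk e u v (dist e u v).
Proof.
case/connectP=> p0 /shortenP[p e_p Up _] def_v.
have ltp : size p < #|T| by have := max_card (mem (u :: p)); rewrite (card_uniqP Up).
have wp : walk e u v (size p).
  by apply/existsP; exists (in_tuple p); rewrite /= e_p def_v eqxx.
have : dist e u v = #|T| \/ walk e u v (dist e u v).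
  rewrite /dist; elim/big_ind: _ => [|x y hx hy|i w]; [by left| |by right].
  by rewrite /minn; case: ifP.
by case=> // dT; have := dist_le_walk wp; rewrite dT leqNgt ltp.
Qed.

Definition ball (T : finType) (e : rel T) (r : nat) (v : T) : {set T} :=
  [set u | dist e u v <= r].

Definition dominating_broadcast (T : finType) (e : rel T) (f : T -> nat) : Prop :=
  forall u : T, exists v : T, 0 < f v /\ dist e u v <= f v.

Definition broadcast_cost (T : finType) (f : T -> nat) : nat := \sum_(v : T) f v.

Definition is_broadcast_cost (T : finType) (e : rel T) (n : nat) : Prop :=
  exists f : T -> nat, dominating_broadcast e f /\ broadcast_cost f = n.

Lemma broadcast_cost_exists (T : finType) (e : rel T) :
  exists n, `[< is_broadcast_cost e n >].
Proof.
exists (broadcast_cost (fun _ : T => 1)); apply/asboolP.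
exists (fun=> 1); split=> // u; exists u; split=> //.
apply: (@leq_trans 0) => //; apply: dist_le_walk.
by apply/existsP; exists [tuple]; rewrite /= eqxx.
Qed.

Definition broadcast_number (T : finType) (e : rel T) : nat :=
  ex_minn (broadcast_cost_exists e).

Definition multipacking (T : finType) (e : rel T) (P : {set T}) : Prop :=
  forall (v : T) (r : nat), 0 < r -> #|ball e r v :&: P| <= r.

Definition multipacking_number (T : finType) (e : rel T) : nat :=
  \max_(P : {set T} | `[< multipacking e P >]) #|P|.

(* Main.v *)
Require Import Defs.
From mathcomp Require Import all_boot.
From mathcomp.classical Require Import boolp.
From mathcomp Require Import zify.

Set Implicit Arguments.
Unset Strict Implicit.
Unset Printing Implicit Defensive.

(** Let [u], [v] realise the diameter [D], put [k = D / 6], and let [x] be at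
    distance [3k] from [u] on a geodesic from [u] to [v].  Broadcasting from
    [x] alone costs at most [max 1 R], where [R] is the eccentricity of [x].
    Conversely, take every third vertex on the geodesic at distance at most
    [3k] from [x], leaving out [u], and every third vertex at distance more
    than [3k] from [x] on a geodesic from [x] to a farthest vertex.  These
    [k + R / 3] vertices form a multipacking; since [R <= D] the inequality
    follows.  A ball of radius [r] meets a geodesic in diameter at most [2r],
    and its distances to [x] range over an interval of length [2r]; the two
    facts together bound the number of chosen vertices in it by [r]. *)

Lemma walk0 (T : finType) (e : rel T) (u : T) : walk e u u 0.
Proof. by apply/existsP; exists [tuple]; rewrite /= eqxx. Qed.

Lemma walk_cat (T : finType) (e : rel T) (u v w : T) (m n : nat) :
  walk e u v m -> walk e v w n -> walk e u w (m + n).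
Proof.
case/existsP=> p /andP[ep /eqP lp] /existsP[q /andP[eq_ /eqP lq]].
by apply/existsP; exists (cat_tuple p q); rewrite /= cat_path last_cat ep lp eq_ lq /=.
Qed.

Lemma walk_sym (T : finType) (e : rel T) (e_sym : symmetric e) (u v : T) (n : nat) :
  walk e u v n -> walk e v u n.
Proof.
case/existsP=> p /andP[ep /eqP lp].
have sz : size (rev (belast u p)) == n by rewrite size_rev size_belast size_tuple.
apply/existsP; exists (Tuple sz) => /=.
rewrite -lp rev_path (eq_path (e' := e)) ?ep; last by move=> a b; rewrite /= e_sym.
case: (val p) => //= a q.
by rewrite rev_cons last_rcons.
Qed.

Lemma dist_refl (T : finType) (e : rel T) (u : T) : dist e u u = 0.
Proof. by apply/eqP; rewrite -leqn0; apply/dist_le_walk/walk0. Qed.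

Lemma dist_sym (T : finType) (e : rel T) (e_sym : symmetric e)
  (e_conn : connected_graph e) (u v : T) : dist e u v = dist e v u.
Proof.
by apply/eqP; rewrite eqn_leq !dist_le_walk //; apply: walk_sym => //; apply: walk_dist.
Qed.

Lemma dist_triangle (T : finType) (e : rel T) (e_conn : connected_graph e)
  (u v w : T) : dist e u w <= dist e u v + dist e v w.
Proof. by apply/dist_le_walk/(@walk_cat _ _ _ v); apply: walk_dist. Qed.

Lemma geodesic (T : finType) (e : rel T) (e_sym : symmetric e)
    (e_conn : connected_graph e) (u v : T) :
  exists g : nat -> T, [/\ g 0 = u, g (dist e u v) = v
    & forall i j, i <= j <= dist e u v -> dist e (g i) (g j) = j - i].
Proof.
have /existsP[p /andP[ep /eqP lp]] := walk_dist (e_conn u v).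
pose g i := nth u (u :: p) i.
have gd : g (dist e u v) = v.
  by rewrite -[RHS]lp (last_nth u) size_tuple.
have step i : i < dist e u v -> walk e (g i) (g i.+1) 1.
  move=> lti; apply/existsP; exists [tuple g i.+1].
  rewrite /= eqxx !andbT.
  by move/(pathP u): ep => /(_ i); rewrite size_tuple; apply.
have le i n : i + n <= dist e u v -> dist e (g i) (g (i + n)) <= n.
  elim: n => [|n IHn] h; first by rewrite addn0 dist_refl.
  rewrite addnS in h *.
  have := dist_le_walk (step (i + n) h).
  have := IHn (ltnW h).
  have := dist_triangle e_conn (g i) (g (i + n)) (g (i + n).+1).
  lia.
exists g; split=> // i j /andP[lij ljd].
(* The three pieces have lengths at most [i], [j - i] and [dist e u v - j], which add up to the
   whole distance, so the triangle inequality forces equality in the middle. *)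
have := le 0 i; have := le i (j - i); have := le j (dist e u v - j).
rewrite !subnKC // gd add0n /g /= -/(g i) -/(g j).
have := dist_triangle e_conn u (g i) v.
have := dist_triangle e_conn (g i) (g j) v.
lia.
Qed.

Lemma leq_size_iota (s : seq nat) (a n : nat) :
  uniq s -> (forall i, i \in s -> a <= i < a + n) -> size s <= n.
Proof.
move=> Us sub; rewrite -[n in _ <= n](size_iota a).
by apply: uniq_leq_size => // i /sub; rewrite mem_iota.
Qed.

Lemma leq_size_iota2 (s : seq nat) (a m b n : nat) :
  uniq s -> (forall i, i \in s -> (a <= i < a + m) || (b <= i < b + n)) ->
  size s <= m + n.
Proof.
move=> Us sub; rewrite -[m in _ <= m + _](size_iota a) -[n in _ <= _ + n](size_iota b).
by rewrite -size_cat; apply: uniq_leq_size => // i /sub; rewrite mem_cat !mem_iota.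
Qed.

Lemma seq_minn (s : seq nat) :
  s = [::] \/ exists2 i0, i0 \in s & forall i, i \in s -> i0 <= i.
Proof.
case: s => [|a s]; [by left | right].
have ex : exists i, i \in a :: s by exists a; rewrite mem_head.
by case: (ex_minnP ex) => i0 ? ?; exists i0.
Qed.

(** Consecutive chosen vertices are 3 apart on their geodesic, and two points of the ball are at
    most [2 * r] apart. *)
Lemma leq_size_spread (s : seq nat) (r : nat) :
  uniq s -> (forall i j, i \in s -> j \in s -> 3 * j <= 3 * i + 2 * r) ->
  size s <= (2 * r) %/ 3 + 1.
Proof.
move=> Us spread; case: (seq_minn s) => [-> //|[i0 s0 min0]].
apply: (@leq_size_iota _ i0) => // i si.
have := min0 i si; have := spread i0 i s0 si; lia.
Qed.

(* [s] and [s'] index the chosen vertices, on the first and on the second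
   geodesic, lying in a ball of radius [r] whose centre is at distance [t]
   from [x]. *)
Lemma two_geodesics_count (k t r : nat) (s s' : seq nat) :
  0 < r -> uniq s -> uniq s' ->
  (forall i, i \in s -> [/\ 0 < i <= 2 * k, t + 3 * i <= r + 3 * k \/ k < i
     & t + 3 * k <= r + 3 * i \/ i <= k]) ->
  (forall i j, i \in s -> j \in s -> 3 * j <= 3 * i + 2 * r) ->
  (forall j, j \in s' -> 0 < j /\ 3 * k + 3 * j <= t + r) ->
  (forall i j, i \in s' -> j \in s' -> 3 * j <= 3 * i + 2 * r) ->
  size s + size s' <= r.
Proof.
move=> r0 Us Us' near spread near' spread'.
have sz := leq_size_spread Us spread; have sz' := leq_size_spread Us' spread'.
have szs' : size s' <= (t + r) %/ 3 - k.
  by apply: (@leq_size_iota _ 1) => // j /near'; lia.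
(* If [t < 3 * k], the bound in [szs'] is at most [(r - 1) %/ 3], and adding [sz] gives at most
   [r]. *)
case: (ltngtP t (3 * k)) => [ltt|gtt|eqt]; first by lia.
  case: (leqP t (r + 3 * k)) => [le_t|gt_t]; last first.
    have : size s <= 0 by apply: (@leq_size_iota _ 0) => // i /near[]; lia.
    lia.
  (* By [near], each index is within [w] of one of the ends [0] and [2 * k]; as [0] is left out, the
     ends contribute at most [w] and [w.+1]. *)
  pose w := (r + 3 * k - t) %/ 3.
  have : size s <= w + w.+1.
    by apply: (@leq_size_iota2 _ 1 _ (2 * k - w)) => // i /near[]; lia.
  lia.
(* When [t = 3k] the two bounds add up to at most [r] unless [3 %| r]; they are
   then off by one, and the missing endpoint [i = 0] (if [k <= m]) or the middle
   vertex [x], which the ball does not reach (if [m < k]), makes up for it. *)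
case: (boolP (3 %| r)) => [/dvdnP[m def_r]|]; last by lia.
suff : size s <= 2 * m by lia.
case: (leqP k m) => [le_km|lt_mk].
  by apply: (@leq_size_iota _ 1) => // i /near[]; lia.
case: (seq_minn s) => [-> //|[i0 s0 min0]].
case: (leqP i0 m) => [le_i0|gt_i0].
  (* The low indices run from [i0] to [m], the high ones from [2 * k - m] to [i0 + 2 * m] by
     [spread]. *)
  have : size s <= (m + 1 - i0) + (i0 + 3 * m + 1 - 2 * k).
    apply: (@leq_size_iota2 _ i0 _ (2 * k - m)) => // i si.
    have [] := near i si; have := min0 i si; have := spread i0 i s0 si; lia.
  have [] := near i0 s0; lia.
have : size s <= m.+1.
  apply: (@leq_size_iota _ (2 * k - m)) => // i si.
  have [] := near i si; have := min0 i si; lia.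
lia.
Qed.

Lemma multipacking_two_geodesics (T : finType) (e : rel T) (e_sym : symmetric e)
    (e_conn : connected_graph e) (k l : nat) (g h : nat -> T) :
  (forall i j, i <= j <= 6 * k -> dist e (g i) (g j) = j - i) ->
  (forall i j, i <= j <= 3 * k + 3 * l -> dist e (h i) (h j) = j - i) ->
  h 0 = g (3 * k) -> 2 * k + l <= multipacking_number e.
Proof.
move=> geo_g geo_h hg.
pose p i := g (3 * i); pose q j := h (3 * k + 3 * j).
have dsym := dist_sym e_sym e_conn; have tri := dist_triangle e_conn.
have dp i j : i <= j <= 2 * k -> dist e (p i) (p j) = 3 * (j - i).
  by move=> le_ij; rewrite geo_g; lia.
have dq i j : i <= j <= l -> dist e (q i) (q j) = 3 * (j - i).
  by move=> le_ij; rewrite geo_h; lia.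
have dxq j : j <= l -> dist e (p k) (q j) = 3 * k + 3 * j.
  by move=> le_j; rewrite /p -hg geo_h; lia.
pose s := map p (iota 1 (2 * k)) ++ map q (iota 1 l).
have Us : uniq s.
  have inj_p : {in iota 1 (2 * k) &, injective p}.
    move=> i j; rewrite !mem_iota => il jl eq_p.
    have := dp i j; have := dp j i; rewrite eq_p dist_refl; lia.
  have inj_q : {in iota 1 l &, injective q}.
    move=> i j; rewrite !mem_iota => il jl eq_q.
    have := dq i j; have := dq j i; rewrite eq_q dist_refl; lia.
  rewrite cat_uniq !map_inj_in_uniq // !iota_uniq andbT /=.
  (* The distance to [p k] is at most [3 * k] on the first family and larger on the second. *)
  apply/hasPn => _ /mapP[j + ->]; rewrite mem_iota => jl.
  apply/mapP => -[i]; rewrite mem_iota => ik eq_qp.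
  have := dxq j; rewrite eq_qp.
  have := dp i k; have := dp k i; rewrite (dsym (p i)); lia.
pose P := [set y in s].
have <- : #|P| = 2 * k + l.
  by rewrite cardsE (card_uniqP Us) size_cat !size_map !size_iota.
rewrite /multipacking_number.
apply: (@leq_bigmax_cond _ _ (fun P : {set T} => #|P|)); apply/asboolP => c r r0.
pose b := [pred y | dist e c y <= r].
pose s1 := [seq i <- iota 1 (2 * k) | b (p i)].
pose s2 := [seq j <- iota 1 l | b (q j)].
have -> : #|ball e r c :&: P| = size s1 + size s2.
  have -> : size s1 + size s2 = size (filter b s).
    by rewrite filter_cat size_cat !filter_map !size_map.
  rewrite -(card_uniqP (filter_uniq b Us)); apply: eq_card => y.
  by rewrite mem_filter in_setI !in_set dsym.
apply: (@two_geodesics_count k (dist e c (p k))) => //; rewrite ?filter_uniq ?iota_uniq //.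
(* The disjunctions express [t <= r + 3 * |i - k|] without truncated subtraction. *)
- move=> i; rewrite mem_filter mem_iota /= => /andP[bi il].
  have := tri c (p i) (p k); have := tri (p i) c (p k).
  have := dp i k; have := dp k i.
  rewrite (dsym (p k)) (dsym (p i) c); split; lia.
- move=> i j; rewrite !mem_filter !mem_iota /= => /andP[bi il] /andP[bj jl].
  have := tri (p i) c (p j); have := dp i j; rewrite (dsym (p i) c); lia.
- move=> j; rewrite mem_filter mem_iota /= => /andP[bj jl].
  have := tri (p k) c (q j); have := dxq j; rewrite (dsym (p k) c); lia.
- move=> i j; rewrite !mem_filter !mem_iota /= => /andP[bi il] /andP[bj jl].
  have := tri (q i) c (q j); have := dq i j; rewrite (dsym (q i) c); lia.
Qed.

Lemma broadcast_number_le (T : finType) (e : rel T) (f : T -> nat) :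
  dominating_broadcast e f -> broadcast_number e <= broadcast_cost f.
Proof.
move=> dom; rewrite /broadcast_number; case: ex_minnP => n _; apply.
by apply/asboolP; exists f.
Qed.

Lemma broadcast_number_le_ecc (T : finType) (e : rel T) (x : T) (n : nat) :
  (forall y, dist e y x <= n) -> broadcast_number e <= maxn 1 n.
Proof.
(* The value at [x] must be positive even when [n = 0]. *)
move=> ecc; pose f v := if v == x then maxn 1 n else 0.
have <- : broadcast_cost f = maxn 1 n by rewrite /broadcast_cost -big_mkcond big_pred1_eq.
apply: broadcast_number_le => y; exists x.
by rewrite /f eqxx !leq_max ecc orbT.
Qed.

Theorem theorem1 (T : finType) (e : rel T)
    (e_sym : symmetric e) (e_irr : irreflexive e) (e_conn : connected_graph e) :
  broadcast_number e <= 2 * multipacking_number e + 3.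
Proof.
case: (pickP T) => [z _|T0]; last first.
  apply: (@leq_trans 0) => //.
  have <- : broadcast_cost (fun _ : T => 0) = 0 by rewrite /broadcast_cost big1.
  by apply: broadcast_number_le => y; have := T0 y.
have [[u v] _ /= maxD] := @arg_maxnP _ (z, z) predT (fun a => dist e a.1 a.2) isT.
have {}maxD a b : dist e a b <= dist e u v := maxD (a, b) isT.
have [g [_ _ geo_g]] := geodesic e_sym e_conn u v.
set D := dist e u v in maxD geo_g; pose k := D %/ 6.
have [y _ maxR] := @arg_maxnP _ z predT (dist e (g (3 * k))) isT.
have [h [h0 _ geo_h]] := geodesic e_sym e_conn (g (3 * k)) y.
have leRD := maxD (g (3 * k)) y.
set R := dist e _ y in maxR geo_h leRD.
have lekR : 3 * k <= R.
  have := maxR (g 0) isT; rewrite (dist_sym e_sym e_conn) geo_g; lia.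
have : broadcast_number e <= maxn 1 R.
  apply: (@broadcast_number_le_ecc _ _ (g (3 * k))) => w.
  by rewrite (dist_sym e_sym e_conn); apply: maxR.
have : 2 * k + (R %/ 3 - k) <= multipacking_number e.
  apply: (@multipacking_two_geodesics _ _ e_sym e_conn _ _ g h) => // i j le_ij.
    by apply: geo_g; lia.
  by apply: geo_h; lia.
(* Rounding loses at most 5/3 from [D / 3] in [2 * k] and 4/3 from [2 * R / 3] in [2 * (R %/ 3)]:
   together the constant 3, as [R <= D]. *)
lia.
Qed.
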